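(* Let $q$ be a prime power, let $h,n,k$ be positive integers, let $\mathcal C$ be an $[n,k/h]_q^h$ additive code, let $t\ge 1$ be an integer and let $S\subseteq[n]$. Then $$\bigl|\{(c_1,\ldots,c_t)\in\mathcal C^t:\ \operatorname{supp}(\langle c_1,\ldots,c_t\rangle_{\mathbb F_q})=S\}\bigr|=p_{P_{\mathcal C}.S}(q^t),$$ where $P_{\mathcal C}.S:=P_{\mathcal C}/([n]\setminus S)$ is the contraction of the polymatroid $P_{\mathcal C}$ to $S$ and $p_{P_{\mathcal C}.S}$ is its characteristic polynomial.
   Context: $[n]=\{1,\ldots,n\}$. An $[n,k/h]_q^h$ additive code $\mathcal C$ is a $k$-dimensional $\mathbb F_q$-linear subspace of $\mathbb F_{q^h}^n$. For $v\in\mathbb F_{q^h}^n$, $\operatorname{supp}(v)=\{i\in[n]:v_i\ne 0\}$; for an $\mathbb F_q$-subspace $\mathcal D\subseteq\mathcal C$, $\operatorname{supp}(\mathcal D)=\bigcup_{c\in\mathcal D}\operatorname{supp}(c)$. For $A\subseteq[n]$ let $\mathcal C(A)$ be the $\mathbb F_q$-subspace of codewords $c\in\mathcal C$ with $c_i=0$ for all $i\in A$, and let $\rho_{\mathcal C}(A):=k-\dim_{\mathbb F_q}\mathcal C(A)$. The pair $P_{\mathcal C}=([n],\rho_{\mathcal C})$ is an integer polymatroid (i.e. $\rho_{\mathcal C}$ is integer valued, $\rho_{\mathcal C}(\emptyset)=0$, monotone and submodular). For an integer polymatroid $P=(E,\rho)$ and $A\subseteq E$, the contraction $P/A$ is the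 polymatroid on $E\setminus A$ with rank function $X\mapsto\rho(X\cup A)-\rho(A)$. The characteristic polynomial of $P$ is $p_P(z):=\sum_{A\subseteq E}(-1)^{|A|}z^{\rho(E)-\rho(A)}$. *)

(* Defs.v *)
From HB Require Import structures.
From mathcomp Require Import all_boot all_order all_algebra all_field.

Set Implicit Arguments.
Unset Strict Implicit.
Unset Printing Implicit Defensive.

Import GRing.Theory.
Local Open Scope ring_scope.

(* Integer polymatroids.  The ground set is a subset of an ambient finite    *)
(* type, so that contractions stay over the same type; the values of the     *)
(* rank function outside the subsets of the ground set are irrelevant.       *)
Record polymatroid (T : finType) := Polymatroid {
  ground : {set T};
  rk : {set T} -> nat;
  rk0 : rk set0 = 0%N;
  rk_mono : forall A B : {set T},
    A \subset B -> B \subset ground -> (rk A <= rk B)%N;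
  rk_submod : forall A B : {set T},
    A \subset ground -> B \subset ground ->
    (rk (A :|: B) + rk (A :&: B) <= rk A + rk B)%N
}.

Section Contraction.
Variables (T : finType) (P : polymatroid T) (A : {set T}).
Hypothesis sAE : A \subset ground P.

Definition contr_rk (X : {set T}) : nat := (rk P (X :|: A) - rk P A)%N.

Lemma contr_rk0 : contr_rk set0 = 0%N.
Proof. by rewrite /contr_rk set0U subnn. Qed.

Lemma contr_rk_mono (X Y : {set T}) :
  X \subset Y -> Y \subset ground P :\: A -> (contr_rk X <= contr_rk Y)%N.
Proof.
move=> sXY /subset_trans/(_ (subsetDl _ _)) sYE.
by rewrite leq_sub2r // rk_mono ?setSU // subUset sYE.
Qed.

Lemma contr_rk_submod (X Y : {set T}) :
    X \subset ground P :\: A -> Y \subset ground P :\: A ->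
  (contr_rk (X :|: Y) + contr_rk (X :&: Y) <= contr_rk X + contr_rk Y)%N.
Proof.
move=> /subset_trans/(_ (subsetDl _ _)) sXE /subset_trans/(_ (subsetDl _ _)) sYE.
have sE (Z : {set T}) : Z \subset ground P -> Z :|: A \subset ground P.
  by move=> sZ; rewrite subUset sZ.
have le_A (Z : {set T}) : Z \subset ground P -> (rk P A <= rk P (Z :|: A))%N.
  by move=> sZ; rewrite rk_mono ?subsetUr ?sE.
have sUE : X :|: Y \subset ground P by rewrite subUset sXE.
have sIE : X :&: Y \subset ground P by rewrite subIset ?sXE.
have := rk_submod (sE _ sXE) (sE _ sYE).
rewrite -setUIl setUACA setUid => le_rk.
rewrite -(leq_add2r (rk P A + rk P A)) addnACA [leqRHS]addnACA.
by rewrite !subnK ?le_A.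
Qed.

Definition contraction : polymatroid T :=
  Polymatroid contr_rk0 contr_rk_mono contr_rk_submod.

End Contraction.

Definition char_poly_pm (T : finType) (P : polymatroid T) : {poly int} :=
  \sum_(A : {set T} | A \subset ground P)
    (-1) ^+ #|A| *: 'X^(rk P (ground P) - rk P A).

Section AdditiveCodes.
Variables (F : finFieldType) (L : fieldExtType F) (n : nat).

(* The words L^n as a vector space over the small field F; [finvect_type]    *)
(* additionally provides the finType structure needed for counting.          *)
Local Notation word := (finvect_type {ffun 'I_n -> L}).

Definition supp (v : word) : {set 'I_n} := [set i | v i != 0].

Definition supp_space (D : {vspace word}) : {set 'I_n} :=
  \bigcup_(c : word | c \in D) supp c.

Definition coordinate (i : 'I_n) (v : word) : L := v i.

Lemma coordinate_is_linear i : linear (coordinate i).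
Proof. by move=> a u v; rewrite /coordinate !ffunE. Qed.

HB.instance Definition _ i :=
  GRing.isLinear.Build F word L *:%R (coordinate i) (coordinate_is_linear i).

Variable C : {vspace word}.

Definition shortening (A : {set 'I_n}) : {vspace word} :=
  (C :&: \bigcap_(i in A) lker (linfun (coordinate i)))%VS.

Lemma mem_shortening (A : {set 'I_n}) (c : word) :
  (c \in shortening A) = (c \in C) && [forall i in A, c i == 0].
Proof.
rewrite memv_cap; congr (_ && _); rewrite -[LHS]/(c \in _).
apply/idP/forall_inP => [|cA].
  rewrite memvE => /subv_bigcapP cA i /cA.
  by rewrite -memvE memv_ker lfunE.
rewrite memvE; apply/subv_bigcapP => i /cA ci0.
by rewrite -memvE memv_ker lfunE.
Qed.

Definition code_rk (A : {set 'I_n}) : nat := (\dim C - \dim (shortening A))%N.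

Lemma shorteningS (A B : {set 'I_n}) :
  A \subset B -> (shortening B <= shortening A)%VS.
Proof.
move=> sAB; apply/subvP => c; rewrite !mem_shortening => /andP[-> /forall_inP cB].
by apply/forall_inP => i /(subsetP sAB)/cB.
Qed.

Lemma shortening_dim (A : {set 'I_n}) : (\dim (shortening A) <= \dim C)%N.
Proof. exact/dimvS/capvSl. Qed.

Lemma code_rk0 : code_rk set0 = 0%N.
Proof. by rewrite /code_rk /shortening big_set0 capvf subnn. Qed.

Lemma code_rk_mono (A B : {set 'I_n}) :
  A \subset B -> B \subset [set: 'I_n] -> (code_rk A <= code_rk B)%N.
Proof. by move=> sAB _; rewrite leq_sub2l // dimvS // shorteningS. Qed.

Lemma code_rk_submod (A B : {set 'I_n}) :
    A \subset [set: 'I_n] -> B \subset [set: 'I_n] ->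
  (code_rk (A :|: B) + code_rk (A :&: B) <= code_rk A + code_rk B)%N.
Proof.
move=> _ _; pose d (X : {set 'I_n}) := \dim (shortening X).
have le_d : (d A + d B <= d (A :|: B) + d (A :&: B))%N.
  rewrite /d -dimv_sum_cap addnC leq_add ?dimvS //.
    apply/subvP => c; rewrite memv_cap !mem_shortening.
    case/andP=> /andP[-> /forall_inP cA] /andP[_ /forall_inP cB].
    by apply/forall_inP => i /setUP[/cA | /cB].
  by rewrite subv_add !shorteningS ?subsetIl ?subsetIr.
rewrite -(leq_add2r (d (A :|: B) + d (A :&: B))) addnACA.
rewrite !subnK ?shortening_dim //.
apply: leq_trans (leq_add (leqnn _) le_d).
by rewrite addnACA !subnK ?shortening_dim.
Qed.

Definition code_polymatroid : polymatroid 'I_n :=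
  Polymatroid code_rk0 code_rk_mono code_rk_submod.

(* The contraction to S, i.e. of the complement of S. *)
Definition code_contraction (S : {set 'I_n}) : polymatroid 'I_n :=
  @contraction _ code_polymatroid (~: S) (subsetT (~: S)).

End AdditiveCodes.

(* Main.v *)
(* Inclusion-exclusion: the exponent of the characteristic polynomial at A is *)
(* the dimension of the subcode of C vanishing on A and outside S, so the     *)
(* power of q ^ t counts the t-tuples of C supported in S minus A.  Summing   *)
(* with signs over A and exchanging the sums, a tuple with support X inside S *)
(* is counted with weight the alternating sum over the subsets of S minus X,  *)
(* which vanishes unless X = S.                                               *)
Require Import Defs.
From HB Require Import structures.
From mathcomp Require Import all_boot all_order all_algebra all_field.

Set Implicit Arguments.
Unset Strict Implicit.
Unset Printing Implicit Defensive.

Import GRing.Theory.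
Local Open Scope ring_scope.

(** Both sides evaluate one signed double sum over pairs of a tuple [c] of codewords with support
    inside [S] and a set [A] in [S] minus that support. Summing over [A] first isolates the tuples
    with support [S] ([sum_subset_sign]); summing over [c] first gives the polynomial at [q ^ t]
    ([char_poly_code_contraction], [sub_shortening], [card_all_tuple]). *)

(** The sum expands a product over all [i] whose factor is [-1 + 1 = 0] for [i] in [D] and
    [0 + 1 = 1] otherwise. *)
Lemma sum_subset_sign (R : comNzRingType) (T : finType) (D : {set T}) :
  \sum_(A : {set T} | A \subset D) (-1) ^+ #|A| = (D == set0)%:R :> R.
Proof.
transitivity (\prod_i ((if i \in D then -1 else 0) + 1) : R).
  rewrite bigA_distr big_mkcond; apply: eq_bigr => A _.
  rewrite -big_mkcond /=; case: ifPn => [/subsetP sAD | /subsetPn[i iA iD]].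
    by rewrite -prodr_const; apply: eq_bigr => i /sAD ->.
  by rewrite (bigD1 i) //= (negPf iD) mul0r.
have [-> | /set0Pn[i iD]] := eqVneq.
  by rewrite big1 // => i _; rewrite inE add0r.
by rewrite (bigD1 i) //= iD addNr mul0r.
Qed.

Lemma card_all_tuple (T : finType) (A : {pred T}) (t : nat) :
  #|[set c : t.-tuple T | all (fun x => x \in A) c]| = (#|A| ^ t)%N.
Proof.
rewrite -[t in RHS]card_ord -card_ffun_on -!sum1_card.
rewrite (reindex (fun f : {ffun 'I_t -> T} => [tuple f i | i < t])) /=;
  last first.
  exists (fun c => [ffun i => tnth c i]) => [f _|c _].
    by apply/ffunP => i; rewrite ffunE tnth_mktuple.
  by apply: eq_from_tnth => i; rewrite tnth_mktuple ffunE.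
apply: eq_bigl => f; rewrite inE.
apply/all_tnthP/ffun_onP => fA i; first by have := fA i; rewrite tnth_mktuple.
by rewrite tnth_mktuple.
Qed.

Section Support.
Variables (F : finFieldType) (L : fieldExtType F) (n : nat).
Local Notation word := (finvect_type {ffun 'I_n -> L}).
Variable C : {vspace word}.

Lemma sub_shortening (D : {vspace word}) (A : {set 'I_n}) :
  (D <= shortening C A)%VS = (D <= C)%VS && (supp_space D \subset ~: A).
Proof.
apply/subvP/andP => [sD | [/subvP sDC /bigcupsP sDA] c cD].
  split; first by apply/subvP => c /sD; rewrite mem_shortening => /andP[].
  apply/bigcupsP => c /sD; rewrite mem_shortening => /andP[_ /forall_inP cA].
  by apply/subsetP => i; rewrite !inE; apply: contraNN => /cA.
rewrite mem_shortening sDC //=; apply/forall_inP => i iA.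
apply: contraTT iA => ci; rewrite -in_setC; apply: subsetP (sDA c cD) _ _.
by rewrite inE.
Qed.

Lemma shorteningT : shortening C setT = 0%VS.
Proof.
apply/eqP; rewrite -subv0; apply/subvP => c; rewrite mem_shortening memv0.
case/andP=> _ /forall_inP c0; apply/eqP/ffunP => i.
by rewrite ffunE; apply/eqP/c0.
Qed.

(** Only the zero word vanishes everywhere, so the full rank is [\dim C]; the rank of [~: S] then
    cancels from the exponent. Monotonicity of the rank keeps the truncated subtractions exact. *)
Lemma char_poly_code_contraction (S : {set 'I_n}) :
  char_poly_pm (code_contraction C S) =
  \sum_(A : {set 'I_n} | A \subset S)
    (-1) ^+ #|A| *: 'X^(\dim (shortening C (A :|: ~: S))).
Proof.
rewrite /char_poly_pm /= setTD setCK; apply: eq_bigr => A _.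
rewrite /contr_rk /= setUCr /code_rk shorteningT dimv0 subn0.
rewrite subnBA ?leq_sub2l ?dimvS ?shorteningS ?subsetUr //.
by rewrite subnK ?leq_subr // subKn ?shortening_dim.
Qed.

Lemma all_mem_span (t : nat) (c : t.-tuple word) (U : {vspace word}) :
  all (fun x => x \in U) c = (<<c>> <= U)%VS.
Proof. exact/allP/span_subvP. Qed.

End Support.

Theorem theorem3p10 (q h n k t : nat)
    (F : finFieldType) (L : fieldExtType F)
    (hq : #|F| = q) (hh : \dim {:L} = h)
    (h_gt0 : (0 < h)%N) (n_gt0 : (0 < n)%N) (k_gt0 : (0 < k)%N)
    (C : {vspace finvect_type {ffun 'I_n -> L}}) (hk : \dim C = k)
    (t_gt0 : (1 <= t)%N) (S : {set 'I_n}) :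
  (#|[set c : t.-tuple (finvect_type {ffun 'I_n -> L}) |
       all (fun ci => ci \in C) c && (supp_space <<c>>%VS == S)]|)%:Z
  = (char_poly_pm (code_contraction C S)).[(q ^ t)%:Z].
Proof.
transitivity (\sum_(c : t.-tuple (finvect_type {ffun 'I_n -> L}) |
      (<<c>> <= C)%VS && (supp_space <<c>> \subset S))
    \sum_(A : {set 'I_n} | A \subset S :\: supp_space <<c>>%VS)
      (-1) ^+ #|A| : int).
  (* The inner sum is the indicator of [S] lying inside the support, the inclusion missing for
     equality. *)
  under eq_bigr do rewrite sum_subset_sign setD_eq0.
  rewrite -natz -sum1_card natr_sum big_mkcond [RHS]big_mkcond.
  apply: eq_bigr => c _.
  rewrite inE all_mem_span eqEsubset andbA.
  by case: (_ && (_ \subset S)); case: (S \subset _).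
rewrite char_poly_code_contraction horner_sum.
rewrite (exchange_big_dep (fun A : {set 'I_n} => A \subset S)) /=; last first.
  by move=> c A _ /subset_trans; apply; apply: subsetDl.
apply: eq_bigr => A sAS.
(* With [d] the dimension of the shortening, [(q ^ t) ^ d = (q ^ d) ^ t], and [q ^ d] is its number
   of words. *)
rewrite hornerZ hornerXn -natz -natrX -expnM mulnC expnM -hq.
rewrite -(card_vspace (shortening C (A :|: ~: S))) -card_all_tuple.
rewrite mulr_natr -sumr_const; apply: eq_bigl => c.
rewrite inE all_mem_span sub_shortening setCU setCK subsetI subsetD.
by rewrite sAS /= -disjoints_subset disjoint_sym -andbA [X in _ && X]andbC.
Qed.
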